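(* Let $s \geq 3$ be an integer. If $H$ is a noncomplete graph with at most $s$ vertices and $h_1h_2$ is any nonedge of $H$, then $$\mathrm{sat}(n,H,K_s) \geq f_{h_1,h_2}(H)\left(\frac{n^2}{2(s-1)} - \frac{n}{2}\right).$$
   Context: All graphs are finite and simple. A graph $G$ is $F$-free if it contains no (not necessarily induced) subgraph isomorphic to $F$. $G$ is $F$-saturated if $G$ is $F$-free but adding any nonedge to $G$ creates at least one copy of $F$. A copy of $H$ in $G$ is a (not necessarily induced) subgraph of $G$ isomorphic to $H$. $\mathrm{sat}(n,H,F)$ denotes the minimum number of copies of $H$ in an $n$-vertex $F$-saturated graph. $K_m$ is the complete graph on $m$ vertices. Definition of $f_{h_1,h_2}(H)$: for a nonedge $h_1h_2$ of $H$, fix a pair of distinct vertices $u_1,u_2$ of $K_s$. Then $f_{h_1,h_2}(H)$ is the number of copies of $H$ in $K_s$ where the vertices $h_1,h_2$ of $H$ correspond to the vertices $u_1,u_2$, respectively, of $K_s$. *)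

(* Defs.v *)
From mathcomp Require Import all_boot.
Set Implicit Arguments.
Unset Strict Implicit.
Unset Printing Implicit Defensive.

(* A graph with vertex set the finite type T is given by its edge set, a set
   of 2-element subsets of T; a subgraph is a pair (vertex set, edge set), so
   that copies of graphs with isolated vertices are told apart by the whole of
   their vertex set. *)
Definition is_graph (T : finType) (G : {set {set T}}) : bool :=
  [forall e in G, #|e| == 2].

Definition complete (T : finType) : {set {set T}} := [set e : {set T} | #|e| == 2].

Definition is_subgraph (T : finType) (P : {set T} * {set {set T}})
    (G : {set {set T}}) : bool :=
  (P.2 \subset G) && (cover P.2 \subset P.1).

Definition is_iso (U T : finType) (H : {set {set U}})
    (P : {set T} * {set {set T}}) (phi : {ffun U -> T}) : bool :=
  [&& injectiveb phi, phi @: [set: U] == P.1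
    & [forall x, forall y,
         ([set phi x; phi y] \in P.2) == ([set x; y] \in H)]].

Definition copies (U T : finType) (H : {set {set U}}) (G : {set {set T}}) :
    {set {set T} * {set {set T}}} :=
  [set P | is_subgraph P G && [exists phi : {ffun U -> T}, is_iso H P phi]].

Definition is_free (U T : finType) (F : {set {set U}}) (G : {set {set T}}) :
    bool :=
  copies F G == set0.

Definition saturated (U T : finType) (F : {set {set U}}) (G : {set {set T}}) :
    bool :=
  is_free F G &&
  [forall x, forall y,
     (x != y) && ([set x; y] \notin G) ==> ~~ is_free F ([set x; y] |: G)].

Definition is_saturated_graph (U T : finType) (F : {set {set U}})
    (G : {set {set T}}) : bool :=
  is_graph G && saturated F G.

(* The value is 0 when there is no F-saturated graph on n vertices; this cannot
   happen for F = K_s with s >= 2, since a maximal K_s-free graph is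
   K_s-saturated. *)
Definition sat (n : nat) (W U : finType) (H : {set {set W}})
    (F : {set {set U}}) : nat :=
  if [pick G : {set {set 'I_n}} | is_saturated_graph F G] is Some G0 then
    #|copies H [arg min_(G < G0 | is_saturated_graph F G) #|copies H G|]|
  else 0.

(* The number of copies of H in the complete graph on T for which some
   isomorphism from H sends h1 to u1 and h2 to u2. The value does not depend
   on the choice of the distinct vertices u1 and u2. *)
Definition rooted_copies (U T : finType) (H : {set {set U}}) (h1 h2 : U)
    (u1 u2 : T) : nat :=
  #|[set P in copies H (complete T) |
      [exists phi : {ffun U -> T},
         [&& is_iso H P phi, phi h1 == u1 & phi h2 == u2]]]|.

(* Main.v *)
Require Import Defs.
From mathcomp Require Import all_boot all_order all_algebra.
From mathcomp Require Import perm zify ring.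
Set Implicit Arguments.
Unset Strict Implicit.
Unset Printing Implicit Defensive.
Import Order.TTheory GRing.Theory Num.Theory.

(** A saturated graph [G] has many nonedges, and each nonedge forces its own
    copies of [H].

    Being [K_s]-free, [G] has at least [n^2/(2(s-1)) - n/2] nonedges: this is
    Turan's theorem read in the complement ([turan_nonedges]).

    If [e] is a nonedge, adding it to [G] creates a [K_s], which has to use [e]
    ([saturated_nonedge]). So some [s] vertices span every edge except [e] in
    [G]. A copy of [H] placed on these vertices with the nonadjacent [h1], [h2]
    sent to the ends of [e] does not use [e], hence lies in [G]; there are
    [rooted_copies H h1 h2 u1 u2] of them ([rooted_copies_le]).

    The nonedge can be read off such a copy: it is the only pair of vertices of
    the copy that is not an edge of [G]. Copies coming from different nonedges
    are therefore different, and the two counts multiply ([copies_ge]). *)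

(** * Transporting copies along an injection *)

Definition push (S T : finType) (g : S -> T) (P : {set S} * {set {set S}}) :
    {set T} * {set {set T}} :=
  (g @: P.1, [set g @: (d : {set S}) | d in P.2]).

Lemma push_inj (S T : finType) (g : S -> T) : injective g -> injective (push g).
Proof.
by move=> gI [A B] [A' B'] [/(imset_inj gI)-> /(imset_inj (imset_inj gI))->].
Qed.

Lemma imset_pair (S T : finType) (g : S -> T) x y :
  g @: [set x; y] = [set g x; g y].
Proof. by rewrite imsetU1 imset_set1. Qed.

Lemma is_iso_push (U S T : finType) (H : {set {set U}}) P
    (phi : {ffun U -> S}) (g : S -> T) :
  injective g -> is_iso H P phi -> is_iso H (push g P) [ffun x => g (phi x)].
Proof.
move=> gI /and3P[/injectiveP phiI /eqP phiV /'forall_forallP phiE].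
apply/and3P; split.
- by apply/injectiveP => x y; rewrite !ffunE => /gI/phiI.
- rewrite /= -phiV -imset_comp; apply/eqP/eq_imset => x.
  by rewrite ffunE.
- apply/'forall_forallP => x y; rewrite !ffunE -imset_pair.
  by rewrite (mem_imset _ _ (imset_inj gI)) phiE.
Qed.

Lemma push_copy (U S T : finType) (H : {set {set U}}) (K : {set {set S}})
    (G : {set {set T}}) (P : {set S} * {set {set S}}) (g : S -> T) :
  injective g -> (forall d, d \in P.2 -> g @: d \in G) ->
  P \in copies H K -> push g P \in copies H G.
Proof.
move=> gI gG; rewrite !inE => /andP[/andP[_ coverP] /existsP[phi phiP]].
apply/andP; split; last first.
  by apply/existsP; exists [ffun x => g (phi x)]; apply: is_iso_push.
apply/andP; split; first by apply/subsetP => _ /imsetP[d /gG dG ->].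
apply/bigcupsP => _ /imsetP[d dP ->]; apply: imsetS.
exact: subset_trans (bigcup_sup d dP) coverP.
Qed.

(** Containing a copy of [K_s] amounts to having an injection of ['I_s] that
    sends all pairs to edges: the vertex and edge sets of the copy are then its
    images. *)
Lemma not_complete_freeP (s : nat) (T : finType) (G : {set {set T}}) :
  reflect (exists2 g : 'I_s -> T, injective g &
             forall i j, i != j -> [set g i; g j] \in G)
          (~~ is_free (complete 'I_s) G).
Proof.
rewrite /is_free; apply: (iffP (set0Pn _)) => [[P] | [g gI gG]].
  rewrite inE => /andP[/andP[PG _] /existsP[phi]].
  case/and3P=> /injectiveP phiI _ /'forall_forallP phiE.
  exists phi => // i j ij; apply: (subsetP PG).
  by rewrite (eqP (phiE i j)) inE cards2 ij.
exists (push g ([set: 'I_s], complete 'I_s)).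
apply: (@push_copy _ _ _ _ (complete 'I_s)) => //=.
  move=> d; rewrite inE => /cards2P[i [j [ij ->]]].
  by rewrite imset_pair; apply: gG.
rewrite inE /is_subgraph /= subxx subsetT; apply/existsP.
exists [ffun i => i]; apply/and3P; split.
- by apply/injectiveP => i j; rewrite !ffunE.
- by apply/eqP/setP => i; rewrite inE -[i in LHS](ffunE id) imset_f.
- by apply/'forall_forallP => i j; rewrite !ffunE.
Qed.

(** * Turan's bound on the number of nonedges *)

Definition independent (T : finType) (e : rel T) (A : {set T}) : bool :=
  [forall x in A, forall y in A, (x != y) ==> ~~ e x y].

Lemma independentP (T : finType) (e : rel T) (A : {set T}) :
  reflect {in A &, forall x y, x != y -> ~~ e x y} (independent e A).
Proof.
apply: (iffP forall_inP) => hA x => [y xA yA | xA].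
  by apply/implyP; apply: (forall_inP (hA x xA)).
by apply/forall_inP => y yA; apply/implyP; apply: hA.
Qed.

(** Turan's theorem, with [e] read as nonadjacency (loops included), so that
    the [e]-independent sets are the cliques; counting the [N] ordered pairs
    related by [e] gives the bound the homogeneous form [n^2 <= k N].
    Remove a maximal clique [A], of size [a <= k]. By maximality every vertex is
    nonadjacent to some vertex of [A], itself if it lies in [A]; so at least
    [a + 2 (n - a)] of the pairs meet [A], and induction on the rest gives
    [k N >= a (a + 2 (n - a)) + (n - a)^2 = n^2]. *)
Lemma turan_pairs (T : finType) (e : rel T) (k : nat) (V : {set T}) :
  reflexive e -> symmetric e ->
  (forall A : {set T}, A \subset V -> independent e A -> #|A| <= k) ->
  #|V| ^ 2 <= k * \sum_(x in V) \sum_(y in V) e x y.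
Proof.
move=> e_refl e_sym.
have [m] := ubnP #|V|; elim: m V => // m IHm V /ltnSE leVm hk.
have [-> | [v vV]] := set_0Vmem V; first by rewrite cards0.
pose P (A : {set T}) := (A \subset V) && independent e A.
have P0 : P set0 by rewrite /P sub0set; apply/independentP => x y; rewrite inE.
have [A /maxsetP[/andP[AV iA] maxA] _] := maxset_exists P0.
(* Maximality: a vertex of V unrelated to all of A could be added to A. *)
have dom x : x \in V -> exists2 y, y \in A & e x y.
  move=> xV.
  have [xA | xNA] := boolP (x \in A); first by exists x.
  apply/exists_inP; apply: contraR xNA => /exists_inPn noe.
  rewrite -(maxA (x |: A)) ?setU11 ?subsetUr // /P subUset sub1set xV AV /=.
  apply/independentP => y z; rewrite !inE.
  move=> /orP[/eqP-> | yA] /orP[/eqP-> | zA]; first by rewrite eqxx.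
  - by move=> _; apply: noe.
  - by move=> _; rewrite e_sym; apply: noe.
  - by apply/independentP: yA zA.
have ltB : #|V :\: A| < m.
  apply: leq_trans leVm; apply: proper_card.
  rewrite properE subsetDl; apply/subsetPn.
  have [y yA _] := dom _ vV.
  by exists y; rewrite ?(subsetP AV) // inE yA.
have /(IHm _ ltB) IH : forall B : {set T}, B \subset V :\: A ->
    independent e B -> #|B| <= k.
  by move=> B BVA; apply: hk; apply: subset_trans BVA (subsetDl _ _).
pose N (X Y : {set T}) := \sum_(x in X) \sum_(y in Y) e x y.
have splitV (F : T -> nat) :
    \sum_(x in V) F x = \sum_(x in A) F x + \sum_(x in V :\: A) F x.
  rewrite (big_setID A) /=; congr (_ + _).
  by rewrite (setIidPr AV).
have cV : #|V| = #|A| + #|V :\: A| by rewrite -(cardsID A V) (setIidPr AV).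
have NA (X : {set T}) : X \subset V -> #|X| <= N X A.
  move=> XV; rewrite -sum1_card; apply: leq_sum => x xX.
  have [y yA exy] := dom _ (subsetP XV _ xX).
  by rewrite (bigD1 y) //= exy.
have NAA := NA _ AV; have NBA := NA _ (subsetDl V A).
have NAB : N A (V :\: A) = N (V :\: A) A.
  rewrite /N exchange_big; apply: eq_bigr => x _; apply: eq_bigr => y _.
  by rewrite e_sym.
have -> : \sum_(x in V) \sum_(y in V) e x y =
    N A A + N A (V :\: A) + N (V :\: A) A + N (V :\: A) (V :\: A).
  rewrite splitV -addnA; congr (_ + _).
    by rewrite -big_split; apply: eq_bigr => x _; rewrite splitV.
  by rewrite -big_split; apply: eq_bigr => x _; rewrite splitV.
have Ak := hk _ AV iA.
rewrite -/(N _ _) in IH; rewrite cV NAB; nia.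
Qed.

(** Each vertex accounts for one pair (its loop) and each nonedge for two. *)
Lemma nonadjacent_pairs_le (T : finType) (G : {set {set T}}) :
  \sum_x \sum_y ((x == y) || ([set x; y] \notin G))
    <= #|T| + 2 * #|complete T :\: G|.
Proof.
pose Q (p : T * T) := (p.1 != p.2) && ([set p.1; p.2] \notin G).
have -> : \sum_x \sum_y ((x == y) || ([set x; y] \notin G) : nat) =
    #|T| + \sum_(p | Q p) 1.
  rewrite -sum1_card big_mkcond [X in _ = _ + X]big_mkcond /=.
  rewrite -(pair_big xpredT xpredT (fun x y => if Q (x, y) then 1 else 0)) /=.
  rewrite -big_split; apply: eq_bigr => x _.
  rewrite (bigD1 x) // [X in _ = _ + X](bigD1 x) //= /Q /= eqxx.
  rewrite add0n; congr (_ + _); apply: eq_bigr => y yx.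
  by rewrite eq_sym (negPf yx) /=; case: (_ \notin _).
rewrite leq_add2l mulnC -sum_nat_const.
rewrite (partition_big (fun p => [set p.1; p.2]) (mem (complete T :\: G))) /=.
  apply: leq_sum => d; rewrite !inE => /andP[_ /cards2P[a [b [ab ->]]]].
  rewrite sum1dep_card.
  suff /subset_leq_card/leq_trans : [set p : T * T | Q p &
      [set p.1; p.2] == [set a; b]] \subset [set (a, b); (b, a)].
    by apply; rewrite cards2; case: (_ != _).
  apply/subsetP => -[x y]; rewrite !inE /Q /= => /andP[/andP[xy _] /eqP eqd].
  have := set21 x y; have := set22 x y; rewrite eqd !inE.
  by rewrite !xpair_eqE; move: xy => /[swap] /pred2P[]-> /[swap] /pred2P[]->;
    rewrite ?eqxx ?orbT.
by move=> p /andP[xy pG]; rewrite !inE pG cards2 xy.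
Qed.

Lemma card_clique_lt (s : nat) (T : finType) (G : {set {set T}}) (A : {set T}) :
  is_free (complete 'I_s) G ->
  independent (fun x y => (x == y) || ([set x; y] \notin G)) A ->
  #|A| < s.
Proof.
move=> Gfree /independentP iA; rewrite ltnNge; apply: contraL Gfree => sA.
apply/not_complete_freeP; exists (fun i => enum_val (widen_ord sA i)).
  by move=> i j /enum_val_inj/(congr1 val)/= ij; apply: val_inj.
move=> i j ij.
have gij : enum_val (widen_ord sA i) != enum_val (widen_ord sA j).
  by rewrite (inj_eq enum_val_inj).
by have := iA _ _ (enum_valP _) (enum_valP _) gij; rewrite negb_or negbK => /andP[].
Qed.

Lemma turan_nonedges (s : nat) (T : finType) (G : {set {set T}}) :
  0 < s -> is_free (complete 'I_s) G ->
  #|T| ^ 2 <= s.-1 * (#|T| + 2 * #|complete T :\: G|).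
Proof.
move=> s_gt0 Gfree; pose e x y := (x == y) || ([set x; y] \notin G).
have /leq_trans : #|[set: T]| ^ 2 <=
    s.-1 * \sum_(x in [set: T]) \sum_(y in [set: T]) e x y.
  apply: turan_pairs => [x | x y | A _].
  - by rewrite /e eqxx.
  - by rewrite /e eq_sym setUC.
  - by rewrite -ltnS prednK //; apply: card_clique_lt.
rewrite cardsT; apply; rewrite leq_mul2l; apply/orP; right.
under eq_bigl => x do rewrite inE.
under eq_bigr => x _ do under eq_bigl => y do rewrite inE.
exact: nonadjacent_pairs_le.
Qed.

(** * Counting the copies forced by the nonedges *)

(** The copy of [K_s] created by adding [e] must use [e], as [G] is
    [K_s]-free; by the symmetry of [K_s] its labelling can be permuted so that
    [e] is the image of any prescribed pair [u1], [u2]. *)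
Lemma saturated_nonedge (s : nat) (T : finType) (G : {set {set T}})
    (u1 u2 : 'I_s) (e : {set T}) :
  saturated (complete 'I_s) G -> u1 != u2 -> e \in complete T :\: G ->
  exists g : 'I_s -> T, [/\ injective g, [set g u1; g u2] = e &
    forall i j, i != j -> [set g i; g j] \in e |: G].
Proof.
move=> /andP[Gfree /'forall_forallP satG] u12.
rewrite !inE => /andP[eG /cards2P[x [y [xy def_e]]]].
have := satG x y; rewrite xy -def_e eG /= => /not_complete_freeP[g gI gG].
have [i [j [ij gij]]] : exists i, exists j, i != j /\ [set g i; g j] = e.
  have [/existsP[i /existsP[j /andP[ij /eqP gij]]] | noij] :=
    boolP [exists i, exists j, (i != j) && ([set g i; g j] == e)].
    by exists i, j.
  suff : ~~ is_free (complete 'I_s) G by rewrite Gfree.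
  apply/not_complete_freeP; exists g => // i j ij.
  have := gG i j ij; rewrite !inE => /orP[gij | //].
  by case/negP: noij; apply/existsP; exists i; apply/existsP; exists j; rewrite ij.
(* p sends u1 to i and u2 to j: the second transposition fixes i. *)
pose p := (tperm u1 i * tperm (tperm u1 i u2) j)%g.
have pu2 : p u2 = j by rewrite permM tpermL.
have pu1 : p u1 = i.
  rewrite permM tpermL tpermD //; last by rewrite eq_sym.
  by rewrite -[X in _ != X](tpermL u1) (inj_eq perm_inj) eq_sym.
exists (g \o p); split=> [||k l kl] /=.
- exact: inj_comp gI perm_inj.
- by rewrite pu1 pu2.
- by apply: gG; rewrite (inj_eq perm_inj).
Qed.

Definition nonedges (T : finType) (G : {set {set T}}) (A : {set T}) :
  {set {set T}} := [set d in complete T :\: G | d \subset A].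

(** The copies obtained by embedding [K_s] through [saturated_nonedge] are
    recorded together with the fact that [e] is the only nonedge they span;
    this is what separates the families belonging to different [e]. *)
Lemma rooted_copies_le (s : nat) (U T : finType) (H : {set {set U}})
    (h1 h2 : U) (u1 u2 : 'I_s) (G : {set {set T}}) (e : {set T}) :
  [set h1; h2] \notin H -> u1 != u2 ->
  saturated (complete 'I_s) G -> e \in complete T :\: G ->
  rooted_copies H h1 h2 u1 u2
    <= #|[set P in copies H G | nonedges G P.1 == [set e]]|.
Proof.
move=> hne u12 satG eNG.
have [g [gI gu gG]] := saturated_nonedge satG u12 eNG.
rewrite /rooted_copies -(card_imset _ (push_inj gI)); apply: subset_leq_card.
apply/subsetP => Q /imsetP[P]; rewrite inE => /andP[Pcopy].
case/existsP=> phi /and3P[isoP /eqP phi1 /eqP phi2] {Q}->.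
rewrite inE; apply/andP; split.
  (* The copy avoids e, because e is the image of the nonedge h1 h2 of H. *)
  apply: push_copy (Pcopy) => // d dP.
  move: Pcopy; rewrite inE => /andP[/andP[PK _] _].
  have := subsetP PK _ dP; rewrite inE => /cards2P[i [j [ij def_d]]].
  have := gG i j ij; rewrite -imset_pair -def_d in_setU1 => /orP[/eqP gd|//].
  case/negP: hne; case/and3P: isoP => _ _ /'forall_forallP phiE.
  rewrite -(eqP (phiE h1 h2)) phi1 phi2.
  by rewrite -gu -imset_pair in gd; rewrite -(imset_inj gI gd).
apply/eqP/setP => d; rewrite !inE.
apply/idP/eqP => [/andP[/andP[dG /cards2P[x [y [xy def_d]]]]] | ->].
  rewrite def_d subUset !sub1set => /andP[/imsetP[i _ xi] /imsetP[j _ yj]].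
  have ij : i != j by apply: contraNneq xy => ij; rewrite xi yj ij.
  have := gG i j ij; rewrite -xi -yj -def_d in_setU1 (negPf dG) orbF.
  by move/eqP.
move: eNG; rewrite !inE => ->; rewrite -gu subUset !sub1set -phi1 -phi2 /=.
by case/and3P: isoP => _ /eqP <- _; rewrite /= !imset_f.
Qed.

(** Double counting: a copy whose only spanned nonedge is [e] is counted for
    that [e] alone. *)
Lemma copies_ge (s : nat) (U T : finType) (H : {set {set U}})
    (h1 h2 : U) (u1 u2 : 'I_s) (G : {set {set T}}) :
  [set h1; h2] \notin H -> u1 != u2 -> saturated (complete 'I_s) G ->
  rooted_copies H h1 h2 u1 u2 * #|complete T :\: G| <= #|copies H G|.
Proof.
move=> hne u12 satG; rewrite mulnC -sum_nat_const.
have /leq_trans : \sum_(e in complete T :\: G) rooted_copies H h1 h2 u1 u2 <=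
    \sum_(e in complete T :\: G)
      #|[set P in copies H G | nonedges G P.1 == [set e]]|.
  by apply: leq_sum => e; apply: rooted_copies_le.
apply; under eq_bigr => e _ do rewrite -sum1dep_card.
rewrite (exchange_big_dep (mem (copies H G))) /=; last by move=> ? ? _ /andP[].
rewrite -[X in _ <= X]sum1_card; apply: leq_sum => P PG.
rewrite sum1dep_card.
apply/card_le1_eqP => d d'.
by rewrite !inE => /and3P[_ _ /eqP->] /and3P[_ _ /eqP/set1_inj].
Qed.

(** * Saturated graphs exist and the minimum is attained *)

(** A maximal [K_s]-free graph is saturated; the edgeless graph is a starting
    point because [K_s] has an edge. *)
Lemma saturated_graph_exists (s : nat) (T : finType) :
  1 < s -> exists G : {set {set T}}, is_saturated_graph (complete 'I_s) G.
Proof.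
move=> s_gt1.
pose P (G : {set {set T}}) := is_graph G && is_free (complete 'I_s) G.
have P0 : P set0.
  apply/andP; split; first by apply/forall_inP => e; rewrite inE.
  apply/negPn/not_complete_freeP => -[g _ gG].
  have := gG (Ordinal (ltnW s_gt1)) (Ordinal s_gt1) isT.
  by rewrite inE.
have [G /maxsetP[/andP[Ggraph Gfree] Gmax] _] := maxset_exists P0.
exists G; rewrite /is_saturated_graph Ggraph /saturated Gfree.
apply/'forall_forallP => x y; apply/implyP => /andP[xy xyG].
apply: contra xyG => free'; rewrite -(Gmax ([set x; y] |: G)) ?setU11 ?subsetUr //.
rewrite /P free' andbT; apply/forall_inP => e.
by rewrite in_setU1 => /orP[/eqP-> | /(forall_inP Ggraph)//]; rewrite cards2 xy.
Qed.

Lemma satP (n : nat) (W U : finType) (H : {set {set W}}) (F : {set {set U}}) :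
  (exists G : {set {set 'I_n}}, is_saturated_graph F G) ->
  exists2 G : {set {set 'I_n}}, is_saturated_graph F G & sat n H F = #|copies H G|.
Proof.
rewrite /sat => -[G satG]; case: pickP => [G0 satG0 | /(_ G)]; last by rewrite satG.
by case: arg_minnP => // G1 satG1 _; exists G1.
Qed.

Local Open Scope ring_scope.

Theorem proposition1p5 (s : nat) (hs : (3 <= s)%N)
    (U : finType) (H : {set {set U}}) (hH : is_graph H)
    (hnc : H != complete U) (hU : (#|U| <= s)%N)
    (h1 h2 : U) (h12 : h1 != h2) (hne : [set h1; h2] \notin H)
    (u1 u2 : 'I_s) (u12 : u1 != u2) (n : nat) :
  (rooted_copies H h1 h2 u1 u2)%:R
    * (n%:R ^+ 2 / (2%:R * (s%:R - 1)) - n%:R / 2%:R)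
  <= (sat n H (complete 'I_s))%:R :> rat.
Proof.
have [G /andP[_ satG] ->] := satP H (saturated_graph_exists 'I_n (ltnW hs)).
have s_gt0 : (0 < s)%N by apply: leq_trans hs.
have := copies_ge hne u12 satG; have := turan_nonedges s_gt0 (andP satG).1.
rewrite card_ord; set m := #|_ :\: _|; set f := rooted_copies _ _ _ _ _.
rewrite -(ler_nat rat) natrM natrD natrM natrX => turan.
rewrite -(ler_nat rat) natrM; apply: le_trans; apply: ler_wpM2l => //.
have -> : s%:R - 1 = s.-1%:R :> rat by rewrite -[s in LHS]prednK // -natr1 addrK.
have r_gt0 : 0 < s.-1%:R :> rat by rewrite ltr0n; lia.
rewrite lerBlDr ler_pdivrMr ?mulr_gt0 //; apply: le_trans turan _.
by rewrite le_eqVlt; apply/predU1P; left; field.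
Qed.
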